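(* Let $A_i\in\mathbb{R}^{n\times n}$, $B_i\in\mathbb{R}^{n\times m}$, $C_i\in\mathbb{R}^{n\times n}$, and let $\xi_i^{12}=\xi_i^{21}\in\mathbb{R}$ be a known scalar. Suppose there are matrices $\tilde K_i\in\mathbb{R}^{m\times n}$, $\bar P_i=\bar P_i^\top\in\mathbb{R}^{n\times n}$, $\tilde K_{ii},\hat K_{ii}\in\mathbb{R}^{m\times n}$ and scalars $\bar\xi_i^{11},\xi_i^{22},\bar\eta_{ii}^{11},\bar\eta_{ii}^{21},\bar\eta_{ii}^{22}$ such that $\bar P_i>0$, $\bar\xi_i^{11}>0$, $\xi_i^{22}<0$, $\bar\eta_{ii}^{22}<0$, $$\begin{bmatrix}\bar\xi_i^{11}\mathbf{I}&\mathbf{0}&B_i\tilde K_{ii}&\bar\xi_i^{11}\mathbf{I}\\ \star&-\bar\eta_{ii}^{22}\mathbf{I}&-\bar\eta_{ii}^{22}\mathbf{I}&\mathbf{0}\\ \star&\star&-\mathcal{H}(B_i\hat K_{ii})+\mathbf{I}&-\xi_i^{21}\mathbf{I}+\bar\eta_{ii}^{21}\mathbf{I}\\ \star&\star&\star&\bar\eta_{ii}^{11}\mathbf{I}\end{bmatrix}\ge0,$$ and $$\begin{bmatrix}\mathbf{I}&\mathbf{0}&C_i\bar P_i&\mathbf{0}\\ \star&\bar P_i&A_i\bar P_i+B_i\tilde K_i&(-\xi_i^{22})\mathbf{I}\\ \star&\star&\bar P_i&\xi_i^{21}\bar P_iC_i^\top\\ \star&\star&\star&\bar\xi_i^{11}\mathbf{I}\end{bmatrix}\ge0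 .$$ Then, with $K_i=\tilde K_i\bar P_i^{-1}$ and $\xi_i^{11}=(-\xi_i^{22})^{-1}\bar\xi_i^{11}$, the closed-loop subsystem $$x_i(t+1)=(A_i+B_iK_i)x_i(t)+\tilde u_i(t),\qquad y_i(t)=C_ix_i(t)$$ is $\mathcal{X}_i$-dissipative from $\tilde u_i$ to $y_i$, where $\mathcal{X}_i=[\xi_i^{kl}\mathbf{I}]_{k,l\in\{1,2\}}$ with $\xi_i^{11}>0$ and $\xi_i^{22}<0$.
   Context: Matrix inequalities are between symmetric matrices ($>0$ positive definite, $\ge 0$ positive semidefinite); $\star$ denotes blocks determined by symmetry; $\mathcal{H}(M)=M+M^\top$. Standing assumption: the desired subsystem dissipativity matrix has blocks that are scalar multiples of the identity, $\mathcal{X}_i^{kl}=\xi_i^{kl}\mathbf{I}$, so input $\tilde u_i$, state $x_i$ and output $y_i$ all have dimension $n$; the off-diagonal scalars $\xi_i^{12}=\xi_i^{21}$ are prescribed. The barred scalars $\bar\eta_{ii}^{kl}$ and matrices $\tilde K_{ii},\hat K_{ii}$ are auxiliary decision variables (the first matrix inequality is a relaxed necessary condition for a later network-level design problem). Dissipativity: a discrete-time system $x(t+1)=f(x(t),u(t))$, $y(t)=h(x(t),u(t))$ is $\mathcal{X}$-dissipative from $u$ to $y$, where $\mathcal{X}=\mathcal{X}^\top=[\mathcal{X}^{kl}]_{k,l\in\{1,2\}}$, if there is a storage function $V$ of the state with $V(0)=0$, $V(x)>0$ for all $x\ne 0$, and $$V(x(t+1))-V(x(t))\le\begin{bmatrix}u(t)\\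 y(t)\end{bmatrix}^\top\begin{bmatrix}\mathcal{X}^{11}&\mathcal{X}^{12}\\ \mathcal{X}^{21}&\mathcal{X}^{22}\end{bmatrix}\begin{bmatrix}u(t)\\ y(t)\end{bmatrix}$$ for all $t\in\{0,1,2,\dots\}$, all input sequences and all corresponding trajectories. *)

(* Defs.v *)
From mathcomp Require Import all_boot all_order all_algebra.
From mathcomp Require Import reals.

Set Implicit Arguments.
Unset Strict Implicit.
Unset Printing Implicit Defensive.

Import Order.TTheory GRing.Theory Num.Theory.
Local Open Scope ring_scope.

Definition quadform (R : realType) (n : nat) (M : 'M[R]_n) (x : 'cV[R]_n) : R :=
  (x^T *m M *m x) 0 0.

(* Matrix inequalities are between symmetric matrices only, so symmetry is
   part of both definiteness predicates. *)
Definition posdefmx (R : realType) (n : nat) (M : 'M[R]_n) : Prop :=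
  M^T = M /\ forall x : 'cV[R]_n, x != 0 -> 0 < quadform M x.

Definition possemidefmx (R : realType) (n : nat) (M : 'M[R]_n) : Prop :=
  M^T = M /\ forall x : 'cV[R]_n, 0 <= quadform M x.

Definition addtr (R : realType) (n : nat) (M : 'M[R]_n) : 'M[R]_n := M + M^T.

(* The 4 x 4 block matrix given by its upper triangle; each block below the
   diagonal (written with a star in the literature) is the transpose of its
   mirror image. *)
Definition symblock4 (R : realType) (n : nat)
    (M11 M12 M13 M14 M22 M23 M24 M33 M34 M44 : 'M[R]_n) :
    'M[R]_((n + n) + (n + n)) :=
  block_mx
    (block_mx M11   M12
              M12^T M22)
    (block_mx M13   M14
              M23   M24)
    (block_mx M13^T M23^T
              M14^T M24^T)
    (block_mx M33   M34
              M34^T M44).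

Definition trajectory (R : realType) (n p q : nat)
    (f : 'cV[R]_n -> 'cV[R]_p -> 'cV[R]_n)
    (h : 'cV[R]_n -> 'cV[R]_p -> 'cV[R]_q)
    (u : nat -> 'cV[R]_p) (x : nat -> 'cV[R]_n) (y : nat -> 'cV[R]_q) : Prop :=
  forall t : nat, x t.+1 = f (x t) (u t) /\ y t = h (x t) (u t).

(* The supply rate weights the stacked vector (input, output), in this order;
   trajectories may start from any initial state. *)
Definition dissipative (R : realType) (n p q : nat)
    (f : 'cV[R]_n -> 'cV[R]_p -> 'cV[R]_n)
    (h : 'cV[R]_n -> 'cV[R]_p -> 'cV[R]_q)
    (X : 'M[R]_(p + q)) : Prop :=
  X^T = X /\
  exists V : 'cV[R]_n -> R,
    [/\ V 0 = 0,
        forall x, x != 0 -> 0 < V x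
      & forall u x y, trajectory f h u x y ->
        forall t : nat, V (x t.+1) - V (x t) <= quadform X (col_mx (u t) (y t))].

(* Main.v *)
(* Evaluate the second matrix inequality at the vector with blocks
   (- C x, - Q z, Q x, s^-1 u), where Q is the inverse of Pbar, s = - xi22 and
   z is the successor of the state x under the input u.  The first two blocks
   minimize the quadratic form in those coordinates (a Schur complement), and
   the result is s^-1 times the dissipation inequality for the storage function
   V x = s x^T Q x. *)
Require Import Defs.
From mathcomp Require Import all_boot all_order all_algebra.
From mathcomp Require Import reals ring.
Import Order.TTheory GRing.Theory Num.Theory.
Local Open Scope ring_scope.

Set Implicit Arguments.
Unset Strict Implicit.
Unset Printing Implicit Defensive.

Definition dot (R : realType) (n : nat) (x y : 'cV[R]_n) : R := (x^T *m y) 0 0.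

Lemma dotC (R : realType) (n : nat) (x y : 'cV[R]_n) : dot x y = dot y x.
Proof. by rewrite /dot -[y^T *m x]trmxK trmx_mul trmxK [RHS]mxE. Qed.

Lemma dotDr (R : realType) (n : nat) (x y z : 'cV[R]_n) :
  dot x (y + z) = dot x y + dot x z.
Proof. by rewrite /dot mulmxDr mxE. Qed.

Lemma dotZr (R : realType) (n : nat) (a : R) (x y : 'cV[R]_n) :
  dot x (a *: y) = a * dot x y.
Proof. by rewrite /dot -scalemxAr mxE. Qed.

Lemma dotNr (R : realType) (n : nat) (x y : 'cV[R]_n) :
  dot x (- y) = - dot x y.
Proof. by rewrite /dot mulmxN mxE. Qed.

Lemma dotZl (R : realType) (n : nat) (a : R) (x y : 'cV[R]_n) :
  dot (a *: x) y = a * dot x y.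
Proof. by rewrite dotC dotZr dotC. Qed.

Lemma dotNl (R : realType) (n : nat) (x y : 'cV[R]_n) :
  dot (- x) y = - dot x y.
Proof. by rewrite dotC dotNr dotC. Qed.

Lemma dot_mulmxl (R : realType) (n p : nat) (M : 'M[R]_(n, p))
    (x : 'cV[R]_p) (y : 'cV[R]_n) :
  dot (M *m x) y = dot x (M^T *m y).
Proof. by rewrite /dot trmx_mul mulmxA. Qed.

Lemma quadformE (R : realType) (n : nat) (M : 'M[R]_n) (x : 'cV[R]_n) :
  quadform M x = dot x (M *m x).
Proof. by rewrite /quadform /dot mulmxA. Qed.

Lemma dot_col_mx (R : realType) (n p : nat) (x y : 'cV[R]_n) (z w : 'cV[R]_p) :
  dot (col_mx x z) (col_mx y w) = dot x y + dot z w.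
Proof. by rewrite /dot tr_col_mx mul_row_col mxE. Qed.

Lemma quadform_block (R : realType) (n p : nat) (M11 : 'M[R]_n)
    (M12 : 'M[R]_(n, p)) (M21 : 'M[R]_(p, n)) (M22 : 'M[R]_p)
    (x : 'cV[R]_n) (y : 'cV[R]_p) :
  quadform (block_mx M11 M12 M21 M22) (col_mx x y) =
  quadform M11 x + dot x (M12 *m y) + dot y (M21 *m x) + quadform M22 y.
Proof. by rewrite !quadformE mul_block_col dot_col_mx !dotDr !addrA. Qed.

(** A block and its mirror image contribute the same scalar, since a scalar equals its transpose;
    hence the factor 2. The diagonal blocks need not be symmetric for this. *)
Lemma quadform_symblock4 (R : realType) (n : nat)
    (M11 M12 M13 M14 M22 M23 M24 M33 M34 M44 : 'M[R]_n) (a b c d : 'cV[R]_n) :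
  quadform (symblock4 M11 M12 M13 M14 M22 M23 M24 M33 M34 M44)
    (col_mx (col_mx a b) (col_mx c d)) =
  dot a (M11 *m a) + dot b (M22 *m b) + dot c (M33 *m c) + dot d (M44 *m d)
  + 2 * (dot a (M12 *m b) + dot a (M13 *m c) + dot a (M14 *m d)
         + dot b (M23 *m c) + dot b (M24 *m d) + dot c (M34 *m d)).
Proof.
have trE (M : 'M[R]_n) (v w : 'cV[R]_n) : dot w (M^T *m v) = dot v (M *m w).
  by rewrite -dot_mulmxl dotC.
rewrite quadform_block !quadform_block !mul_block_col !dot_col_mx !dotDr !trE.
rewrite !quadformE; ring.
Qed.

(** A nonzero row [r] of the left kernel would satisfy [r P r^T = 0], against positivity at
    [r^T]. *)
Lemma posdefmx_unit (R : realType) (n : nat) (P : 'M[R]_n) :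
  posdefmx P -> P \in unitmx.
Proof.
case=> _ Ppos; rewrite -row_free_unit -kermx_eq0.
apply/eqP/row_matrixP => i; rewrite row0; apply/eqP/negPn/negP => ri_neq0.
have := Ppos (row i (kermx P))^T; rewrite trmx_eq0 => /(_ ri_neq0).
by rewrite /quadform trmxK -row_mul mulmx_ker row0 mul0mx mxE ltxx.
Qed.

(** Substitute [x = P w] with [w = P^-1 x]. This carries positivity over to the inverse, which
    weights the storage function. *)
Lemma quadform_invmx (R : realType) (n : nat) (P : 'M[R]_n) (x : 'cV[R]_n) :
  posdefmx P -> quadform (invmx P) x = quadform P (invmx P *m x).
Proof.
move=> Ppos; have Punit := posdefmx_unit Ppos.
by rewrite !quadformE mulKVmx // dotC.
Qed.

Lemma posdefmx_inv (R : realType) (n : nat) (P : 'M[R]_n) :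
  posdefmx P -> posdefmx (invmx P).
Proof.
move=> Ppos; have Punit := posdefmx_unit Ppos.
case: (Ppos) => Psym Pgt0; split; first by rewrite trmx_inv Psym.
move=> x x_neq0; rewrite quadform_invmx //; apply: Pgt0.
by apply: contra_neq x_neq0 => Qx0; rewrite -(mulKVmx Punit x) Qx0 mulmx0.
Qed.

Theorem proposition5 (R : realType) (n m : nat)
  (A : 'M[R]_n) (B : 'M[R]_(n, m)) (C : 'M[R]_n)
  (xi12 xi21 : R) (hxi : xi12 = xi21)
  (Kt : 'M[R]_(m, n)) (Pbar : 'M[R]_n) (hPsym : Pbar = Pbar^T)
  (Ktii Khii : 'M[R]_(m, n))
  (xibar11 xi22 etabar11 etabar21 etabar22 : R)
  (hP : posdefmx Pbar)
  (hxibar11 : 0 < xibar11) (hxi22 : xi22 < 0) (hetabar22 : etabar22 < 0)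
  (hLMI1 : possemidefmx (symblock4
     xibar11%:M  0                (B *m Ktii)                    xibar11%:M
                 (- etabar22%:M)  (- etabar22%:M)                0
                                  (- addtr (B *m Khii) + 1%:M)   (- xi21%:M + etabar21%:M)
                                                                 etabar11%:M))
  (hLMI2 : possemidefmx (symblock4
     1%:M  0     (C *m Pbar)               0
           Pbar  (A *m Pbar + B *m Kt)     ((- xi22)%:M)
                 Pbar                      (xi21 *: (Pbar *m C^T))
                                           xibar11%:M)) :
  let K := Kt *m invmx Pbar in
  let xi11 := (- xi22)^-1 * xibar11 in
  [/\ 0 < xi11, xi22 < 0 &
      dissipative
        (fun (x : 'cV[R]_n) (u : 'cV[R]_n) => (A + B *m K) *m x + u)
        (fun (x : 'cV[R]_n) (u : 'cV[R]_n) => C *m x)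
        (block_mx xi11%:M xi12%:M
                  xi21%:M xi22%:M)].
Proof.
move=> K xi11; have s_gt0 : 0 < - xi22 by rewrite oppr_gt0.
have Punit := posdefmx_unit hP.
split=> //; first by rewrite mulr_gt0 ?invr_gt0.
split; first by rewrite tr_block_mx !tr_scalar_mx hxi.
exists (fun x => - xi22 * quadform (invmx Pbar) x); split.
- by rewrite /quadform mulmx0 mxE mulr0.
- by move=> x x_neq0; rewrite mulr_gt0 //; case: (posdefmx_inv hP) => _; apply.
move=> u x y xyP t; have [-> ->] := xyP t.
(* Only the current state, the input and the successor matter, so the trajectory is replaced by an
   arbitrary pair [x], [u]. *)
move: (x t) (u t) => {xyP y} {}x {}u; set z := _ *m x + u.
set Q := invmx Pbar; set y := C *m x; set s := - xi22 in s_gt0 *.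
have lmi := hLMI2.2 (col_mx (col_mx (- y) (- (Q *m z))) (col_mx (Q *m x) (s^-1 *: u))).
have PQ w : Pbar *m (Q *m w) = w by rewrite mulKVmx.
have CPQ : C *m Pbar *m (Q *m x) = y by rewrite -mulmxA PQ.
(* Since [K = Kt Q], the change of variables is undone at [Q x]. The summand [u] is what the (2,4)
   block [s I] makes of [s^-1 u]. *)
have AclE : (A *m Pbar + B *m Kt) *m (Q *m x) + u = z.
  by rewrite mulmxDl -mulmxA PQ /z /K mulmxDl !mulmxA.
(* Symmetry of [Pbar] moves it onto [Q x], giving [x]; then [C^T] moves across as [C], giving
   [y]. *)
have crossE : dot (Q *m x) (xi21 *: (Pbar *m C^T) *m (s^-1 *: u))
    = xi21 * s^-1 * dot u y.
  rewrite -scalemxAl -scalemxAr !dotZr -mulmxA -[X in X *m (_ *m u)]hP.1.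
  by rewrite -dot_mulmxl PQ -dot_mulmxl dotC mulrA.
(* The (2,3) and (2,4) cross terms enter with coefficient -2; together with the (2,2) term they
   leave [- z^T Q z]. *)
have zE : dot (Q *m z) ((A *m Pbar + B *m Kt) *m (Q *m x))
    + dot (Q *m z) u = dot z (Q *m z).
  by rewrite -dotDr AclE dotC.
move: lmi; rewrite quadform_symblock4 crossE CPQ !mul0mx mulmxN !PQ.
rewrite !mulmxN !mul1mx PQ !mul_scalar_mx !dotNl !dotNr.
rewrite -/s (scalerA s) divff ?gt_eqF // scale1r !dotZr dotZl (dotC _ z) (dotC _ x).
have -> : dot y 0 = 0 by rewrite /dot mulmx0 mxE.
(* The factor [s] turns [s^-2 xibar11] into [xi11] and the coefficient -1 of [y^T y] into [xi22]. *)
move=> /(mulr_ge0 (ltW s_gt0)) lmi.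
rewrite quadform_block !quadformE !mul_scalar_mx !dotZr (dotC y u) hxi.
(* No slack is lost: the scaled form equals supply minus storage increase. Expanding [z^T Q z] by
   [zE] gives both sides the same atoms for [field]. *)
rewrite -subr_ge0; apply: le_trans lmi _; rewrite le_eqVlt; apply/orP; left.
apply/eqP; rewrite -[dot z (Q *m z)]zE /xi11 -/s.
have -> : xi22 = - s by rewrite /s opprK.
by field; rewrite gt_eqF.
Qed.
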